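(* Let $G$ be a finite simple graph. Then $m(G) \le 2^{\beta(G)}$, where $m(G)$ is the number of maximal independent sets of $G$ and $\beta(G)$ is the covering number of $G$.
   Context: For a finite simple graph $G$, $m(G)$ denotes the number of maximal independent sets of $G$ (a graph with no edges, including the graph with no vertices, has $m(G)=1$). A vertex cover of $G$ is a set $C\subseteq V(G)$ such that every edge of $G$ has at least one endpoint in $C$; the covering number $\beta(G)$ is the minimum size of a vertex cover of $G$. *)

(* Defs.v *)
From mathcomp Require Import all_boot.

Set Implicit Arguments.
Unset Strict Implicit.
Unset Printing Implicit Defensive.

(* A finite simple graph is an adjacency relation [e : rel T], symmetric and
   irreflexive, on a vertex type [T : finType], which may be empty. *)

Definition independent (T : finType) (e : rel T) (A : {set T}) : bool :=
  [forall x in A, forall y in A, ~~ e x y].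

Definition max_independent_sets (T : finType) (e : rel T) : {set {set T}} :=
  [set A | maxset (independent e) A].

Definition num_max_independent_sets (T : finType) (e : rel T) : nat :=
  #|max_independent_sets e|.

Definition vertex_cover (T : finType) (e : rel T) (C : {set T}) : bool :=
  [forall x, forall y, e x y ==> (x \in C) || (y \in C)].

(* The starting point [set: T] of the minimization is always a vertex cover
   (see [vertex_coverT]), so this is a genuine minimum. *)
Definition covering_number (T : finType) (e : rel T) : nat :=
  #|[arg min_(C < [set: T] | vertex_cover e C) #|C| ]|.

Lemma vertex_coverT (T : finType) (e : rel T) : vertex_cover e [set: T].
Proof. by apply/forallP => x; apply/forallP => y; rewrite inE implybT. Qed.

Lemma covering_numberP (T : finType) (e : rel T) :
  (exists2 C, vertex_cover e C & #|C| = covering_number e) /\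
  (forall C, vertex_cover e C -> covering_number e <= #|C|).
Proof.
rewrite /covering_number; case: arg_minnP => [|C coverC minC].
  exact: vertex_coverT.
by split=> //; exists C.
Qed.

(* Main.v *)
(* For a minimum vertex cover [C], a maximal independent set [A] is determined
   by its trace [A :&: C]: if [A] and [B] have the same trace, an edge between
   them has an endpoint in [C], hence in both sets, which is impossible; so
   [A :|: B] is independent and by maximality equals both [A] and [B]. *)
Require Import Defs.
From mathcomp Require Import all_boot.

Lemma independentP (T : finType) (e : rel T) (A : {set T}) :
  reflect {in A &, forall x y, ~~ e x y} (independent e A).
Proof.
apply: (iffP forall_inP) => [indA x y Ax Ay | indA x Ax].
  exact: (forall_inP (indA x Ax)).
by apply/forall_inP => y; apply: indA.
Qed.

Lemma independent_cross (T : finType) (e : rel T) (C A B : {set T}) :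
  vertex_cover e C -> A :&: C = B :&: C ->
  independent e A -> independent e B ->
  forall x y, x \in A -> y \in B -> ~~ e x y.
Proof.
move=> coverC eqAB /independentP indA /independentP indB x y Ax By.
apply/negP => exy; move/forallP/(_ x)/forallP/(_ y): coverC; rewrite exy /=.
(* Equal traces put the covered endpoint in both sets, so the edge would lie inside [B] if [x] is
   covered, inside [A] if [y] is. *)
case/orP => [Cx | Cy].
  have : x \in B :&: C by rewrite -eqAB inE Ax.
  by rewrite inE => /andP[Bx _]; move: (indB x y Bx By); rewrite exy.
have : y \in A :&: C by rewrite eqAB inE By.
by rewrite inE => /andP[Ay _]; move: (indA x y Ax Ay); rewrite exy.
Qed.

Lemma max_independent_trace_inj (T : finType) (e : rel T) (C : {set T}) :
  vertex_cover e C ->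
  {in max_independent_sets e &, injective (fun A => A :&: C)}.
Proof.
move=> coverC A B; rewrite !inE => /maxsetP[indA maxA] /maxsetP[indB maxB] eqAB.
have indAB : independent e (A :|: B).
  (* Only the two mixed cases need the cover; when [x] is in [B] and [y] in [A], the two sets
     exchange roles. *)
  apply/independentP => x y /setUP[] Hx /setUP[] Hy.
  - exact: (independentP _ _ _ indA).
  - exact: independent_cross coverC eqAB indA indB x y Hx Hy.
  - exact: independent_cross coverC (esym eqAB) indB indA x y Hx Hy.
  - exact: (independentP _ _ _ indB).
by rewrite -(maxA _ indAB (subsetUl A B)) (maxB _ indAB (subsetUr A B)).
Qed.

Theorem theorem2p7 (T : finType) (e : rel T)
    (e_sym : symmetric e) (e_irr : irreflexive e) :
  num_max_independent_sets e <= 2 ^ covering_number e.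
Proof.
have [[C coverC <-] _] := covering_numberP e.
rewrite -card_powerset /num_max_independent_sets.
(* By injectivity it suffices to count the traces, all of which lie in the powerset of [C]. *)
rewrite -(card_in_imset (max_independent_trace_inj _ _ _ coverC)).
apply/subset_leq_card/subsetP => _ /imsetP[A _ ->].
by rewrite powersetE subsetIr.
Qed.
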